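(* Let $\phi:\mathbb{R}^n\to\mathbb{R}$ be a twice continuously differentiable $\mu$-strongly convex function ($\mu>0$) which attains its minimum value $\phi^*$ at $x^*\in\mathbb{R}^n$, and assume $\nabla\phi$ is $L$-Lipschitz continuous. Fix $\alpha,\beta>0$ and $\lambda\in[0,1]$ with $\lambda\le \frac{1}{2\alpha}$. Then there exist constants $C\ge 0$ and $\kappa>0$ such that, for every $z_0\in\mathbb{R}^n$ and every $t>0$, the $\lambda$-extended speed restarted trajectory $\boldsymbol{x}_{z_0}$ starting from $z_0$ is defined on $[0,\infty)$ and satisfies $$\phi(\boldsymbol{x}_{z_0}(t))-\phi^*\le C e^{-\kappa t}\big(\phi(z_0)-\phi^*\big).$$
   Context: For $z\in\mathbb{R}^n$, $x_z\in C^2((0,\infty);\mathbb{R}^n)\cap C^1([0,\infty);\mathbb{R}^n)$ denotes the unique function with $x_z(0)=z$, $\dot x_z(0)=0$ satisfying, for all $t>0$, $$\ddot x(t)+\frac{\alpha}{t}\dot x(t)+\beta\nabla^2\phi(x(t))\dot x(t)+\nabla\phi(x(t))=0 \qquad\text{(DIN-AVD)}.$$ For $z\notin\operatorname{argmin}\phi$, $t>0$ and $\lambda\in[0,1]$ set $\varphi_{z,\lambda}(t)=\frac12\frac{d}{dt}\|\dot x_z(t)\|^2+\lambda\frac{\alpha}{t}\|\dot x_z(t)\|^2$, and define the $\lambda$-extended speed restarting time $T^\lambda(z)=\inf\{t>0:\varphi_{z,\lambda}(t)\le 0\}$. The restarted trajectory $\boldsymbol{x}_{z_0}:[0,\infty)\to\mathbb{R}^n$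 is defined inductively: $T_1=T^\lambda(z_0)$, $\boldsymbol{x}_{z_0}(t)=x_{z_0}(t)$ for $t\in[0,T_1]$, $z_1=\boldsymbol{x}_{z_0}(T_1)$; and for $k\ge1$, $T_{k+1}=T_k+T^\lambda(z_k)$, $\boldsymbol{x}_{z_0}(t)=x_{z_k}(t-T_k)$ for $t\in[T_k,T_{k+1}]$, $z_{k+1}=\boldsymbol{x}_{z_0}(T_{k+1})$ (if some $z_k$ is a minimizer, the trajectory stays constant from then on). *)

(* Defs.v *)
From HB Require Import structures.
From mathcomp Require Import all_boot all_order all_algebra.
From mathcomp Require Import all_classical all_reals all_analysis.
Set Implicit Arguments. Unset Strict Implicit. Unset Printing Implicit Defensive.
Import Order.TTheory GRing.Theory Num.Theory.
Import numFieldNormedType.Exports.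
Local Open Scope classical_set_scope.
Local Open Scope ring_scope.

Section Defs.
Variables (R : realType) (n : nat).
Notation V := 'rV[R]_n.

Definition dotv (u v : V) : R := \sum_(i < n) u 0 i * v 0 i.
Definition sqnorm (u : V) : R := dotv u u.
Definition enorm (u : V) : R := Num.sqrt (sqnorm u).

Definition evec (i : 'I_n) : V := delta_mx 0 i.

Definition gradient (phi : V -> R) (x : V) : V := \row_i 'D_(evec i) phi x.
Definition hessian (phi : V -> R) (x : V) : 'M[R]_n :=
  \matrix_(i, j) 'D_(evec j) (fun y => 'D_(evec i) phi y) x.

Definition C2 (phi : V -> R) : Prop :=
  (forall x, differentiable phi x) /\
  (forall x, differentiable (gradient phi) x) /\
  continuous (hessian phi).

Definition strongly_convex (mu : R) (phi : V -> R) : Prop :=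
  forall (x y : V) (th : R), 0 <= th <= 1 ->
    phi (th *: x + (1 - th) *: y) <=
      th * phi x + (1 - th) * phi y - mu / 2 * th * (1 - th) * sqnorm (x - y).

Definition lipschitz_grad (L : R) (phi : V -> R) : Prop :=
  forall x y, enorm (gradient phi x - gradient phi y) <= L * enorm (x - y).

Definition is_minimizer (phi : V -> R) (z : V) : Prop := forall y, phi z <= phi y.

(* x is the solution of (DIN-AVD) with x(0)=z, x'(0)=0, x in C^2((0,oo)) /\ C^1([0,oo)) *)
Definition din_avd_sol (phi : V -> R) (alpha beta : R) (z : V) (x : R -> V) : Prop :=
  [/\ x 0 = z,
      (fun h => h^-1 *: (x h - x 0)) @ 0^'+ --> (0 : V),
      derive1 x t @[t --> 0^'+] --> (0 : V),
      (forall t, 0 < t -> derivable x t 1 /\ derivable (derive1 x) t 1 /\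
                          {for t, continuous (derive1 (derive1 x))}) &
      (forall t, 0 < t ->
         derive1 (derive1 x) t + (alpha / t) *: derive1 x t
         + beta *: (derive1 x t *m (hessian phi (x t))^T)
         + gradient phi (x t) = 0)].

Definition varphi (alpha lam : R) (x : R -> V) (t : R) : R :=
  2^-1 * derive1 (fun s => sqnorm (derive1 x s)) t + lam * (alpha / t) * sqnorm (derive1 x t).

Definition restart_set (sol : V -> R -> V) (alpha lam : R) (z : V) : set R :=
  [set t | 0 < t /\ varphi alpha lam (sol z) t <= 0].
Definition restart_time (sol : V -> R -> V) (alpha lam : R) (z : V) : R :=
  inf (restart_set sol alpha lam z).

Fixpoint restart_seq (phi : V -> R) (sol : V -> R -> V) (alpha lam : R)
    (z0 : V) (k : nat) : V * R :=
  match k with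
  | 0 => (z0, 0)
  | k'.+1 =>
      let zT := restart_seq phi sol alpha lam z0 k' in
      if `[< is_minimizer phi zT.1 >] then zT
      else (sol zT.1 (restart_time sol alpha lam zT.1),
            zT.2 + restart_time sol alpha lam zT.1)
  end.

Definition restart_piece (phi : V -> R) (sol : V -> R -> V) (alpha lam : R)
    (z0 : V) (k : nat) (t : R) : V :=
  let zT := restart_seq phi sol alpha lam z0 k in
  if `[< is_minimizer phi zT.1 >] then zT.1 else sol zT.1 (t - zT.2).

Definition in_piece (phi : V -> R) (sol : V -> R -> V) (alpha lam : R)
    (z0 : V) (k : nat) (t : R) : Prop :=
  let zT := restart_seq phi sol alpha lam z0 k in
  zT.2 <= t /\ (is_minimizer phi zT.1 \/ t <= (restart_seq phi sol alpha lam z0 k.+1).2).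

End Defs.

(* Main.v *)
Require Import Defs.
From HB Require Import structures.
From mathcomp Require Import all_boot all_order all_algebra.
From mathcomp Require Import all_classical all_reals all_analysis.
From mathcomp Require Import ring lra.
Import Order.TTheory GRing.Theory Num.Theory.
Import numFieldNormedType.Exports.
Local Open Scope classical_set_scope.
Local Open Scope ring_scope.

(** Write [v = x'] and [gam = gradient phi z / (1 + alpha)].  Near [0] the solution
moves like [v(t) = - t gam]: a Gronwall argument for [|v + t gam|^2 + |x - z|^2 / t]
gives, on a window [(0, tau]] depending only on [alpha], [beta], [L], that the restart
criterion is positive and [|v|^2 >= t^2 |gam|^2 / 4].  Before the restart
[d/dt phi(x) <= - beta mu |v|^2], so every piece contracts the gap [phi - phi xstar]
by a uniform factor [exp (- q)], by the Polyak-Lojasiewicz inequality.  Since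
[2 lam alpha <= 1], [t |v|^2] is nondecreasing before the restart, hence
[|v|^2 >= c / t]; as [1 / t] is not integrable at infinity, the gap would become negative
if the restart came too late.  So the restart times are uniformly bounded above, and
geometric decay per piece is exponential decay in time. *)

(** * Calculus of row-vector-valued curves *)

Lemma ler0_is_derive_noninc (R : realType) (f df : R -> R) (a b : R) :
  a <= b -> (forall t, a <= t <= b -> is_derive t 1 f (df t)) ->
  (forall t, a < t < b -> df t <= 0) -> f b <= f a.
Proof.
move=> ab fd df0.
have D t : a <= t <= b -> derivable f t 1 by move=> /fd ?; exact: ex_derive.
apply: (@ler0_derive1_le_cc R f a b); rewrite ?in_itv /= ?lexx ?ab //.
- by move=> t; rewrite in_itv /= => /andP[? ?]; apply: D; lra.
- move=> t; rewrite in_itv /= => /andP[? ?].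
  have tab : a <= t <= b by lra.
  by rewrite derive1E (@derive_val _ _ _ _ _ _ _ (fd t tab)); apply: df0; lra.
- by apply: derivable_within_continuous => t; rewrite in_itv /= => /D.
Qed.

(** The equation is singular at [0], so curves are differentiated on positive times only and the
    right limit plays the role of the initial value. *)
Lemma ler0_is_derive_le_lim (R : realType) (f df : R -> R) (b l : R) :
  f t @[t --> 0^'+] --> l -> (forall t, 0 < t <= b -> is_derive t 1 f (df t)) ->
  (forall t, 0 < t < b -> df t <= 0) -> forall t, 0 < t <= b -> f t <= l.
Proof.
move=> fl fd df0 t /andP[t0 tb].
apply: (cvgr_to_ge fl); near=> s.
have s0 : 0 < s by near: s; exact: nbhs_right_gt.
have st : s <= t by near: s; exact: nbhs_right_le.
by apply: (@ler0_is_derive_noninc R f df) => // r rst; [apply: fd|apply: df0]; lra.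
Unshelve. all: by end_near. Qed.

Section Euclid.
Context {R : realType} {n : nat}.
Implicit Types u v w : 'rV[R]_n.

Lemma dotvC u v : dotv u v = dotv v u.
Proof. by apply: eq_bigr => i _; rewrite mulrC. Qed.

Lemma dotvDl u v w : dotv (u + v) w = dotv u w + dotv v w.
Proof. by rewrite -big_split; apply: eq_bigr => i _; rewrite mxE mulrDl. Qed.

Lemma dotvZl a u v : dotv (a *: u) v = a * dotv u v.
Proof. by rewrite mulr_sumr; apply: eq_bigr => i _; rewrite mxE mulrA. Qed.

Lemma dotvNl u v : dotv (- u) v = - dotv u v.
Proof. by rewrite -scaleN1r dotvZl mulN1r. Qed.

Lemma dotvDr u v w : dotv w (u + v) = dotv w u + dotv w v.
Proof. by rewrite !(dotvC w) dotvDl. Qed.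

Lemma dotvZr a u v : dotv v (a *: u) = a * dotv v u.
Proof. by rewrite !(dotvC v) dotvZl. Qed.

Lemma dotvNr u v : dotv v (- u) = - dotv v u.
Proof. by rewrite !(dotvC v) dotvNl. Qed.

Definition dotvE := (dotvDl, dotvDr, dotvNl, dotvNr, dotvZl, dotvZr).

Lemma dotv0l v : dotv 0 v = 0.
Proof. by rewrite -(scale0r v) dotvZl mul0r. Qed.

Lemma sqnorm_ge0 u : 0 <= sqnorm u.
Proof. by apply: sumr_ge0 => i _; rewrite -expr2 sqr_ge0. Qed.

Lemma sqnorm_enorm u : sqnorm u = enorm u ^+ 2.
Proof. by rewrite sqr_sqrtr ?sqnorm_ge0. Qed.

Lemma enorm_le_sqnorm L u v : enorm u <= L * enorm v -> sqnorm u <= L ^+ 2 * sqnorm v.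
Proof.
by rewrite !sqnorm_enorm -exprMn => uv; rewrite ler_sqr ?nnegrE ?sqrtr_ge0 ?(le_trans (sqrtr_ge0 _) uv).
Qed.

(** Expand [0 <= sqnorm (a *: u - v)] and divide by [a]. *)
Lemma dotv_young (a : R) u v : 0 < a -> 2 * dotv u v <= a * sqnorm u + a^-1 * sqnorm v.
Proof.
move=> a0; have := sqnorm_ge0 (a *: u - v).
rewrite /sqnorm !dotvE (dotvC v u) => H.
rewrite -(ler_pM2l a0) mulrDr (mulrA a a^-1) divff ?gt_eqF // ; nra.
Qed.

Lemma sqnormD_le u v : sqnorm (u + v) <= 2 * sqnorm u + 2 * sqnorm v.
Proof.
have := @dotv_young 1 u v ltr01; rewrite invr1 /sqnorm !dotvE (dotvC v u); lra.
Qed.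

Lemma cvg_dotv (T : Type) (F : set_system T) {FF : ProperFilter F} (f g : T -> 'rV[R]_n) u v :
  f @ F --> u -> g @ F --> v -> dotv (f t) (g t) @[t --> F] --> dotv u v.
Proof.
move=> fu gv; rewrite /dotv.
apply: cvg_big => [|i _]; [exact: add_continuous|apply: cvgM].
  exact: (@continuous_cvg _ _ _ F _ f (fun M => M 0 i) u (@coord_continuous R 1 n 0 i u) fu).
exact: (@continuous_cvg _ _ _ F _ g (fun M => M 0 i) v (@coord_continuous R 1 n 0 i v) gv).
Qed.

Lemma is_derive_coord (f : R -> 'rV[R]_n) (t : R) df i :
  is_derive t 1 f df -> is_derive t 1 (fun s => f s 0 i) (df 0 i).
Proof.
move=> [fd <-]; apply: DeriveDef; first by move/derivable_mxP : fd; exact.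
by rewrite derive_mx // mxE.
Qed.

Lemma is_derive_rowP (f : R -> 'rV[R]_n) (t : R) (df : 'rV[R]_n) :
  (forall i, is_derive t 1 (fun s => f s 0 i) (df 0 i)) -> is_derive t 1 f df.
Proof.
move=> fd; have fD : derivable f t 1.
  by apply/derivable_mxP => i j; rewrite ord1; exact: (@ex_derive _ _ _ _ _ _ _ (fd j)).
apply: DeriveDef => //; rewrite derive_mx //; apply/rowP => j; rewrite mxE.
exact: (@derive_val _ _ _ _ _ _ _ (fd j)).
Qed.

Lemma is_derive_line (u v : 'rV[R]_n) (t : R) : is_derive t 1 (fun s => u + s *: v) v.
Proof.
apply: is_derive_rowP => i.
have -> : (fun s => (u + s *: v) 0 i) = cst (u 0 i) + id * cst (v 0 i).
  by apply/funext => s; rewrite !mxE.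
by apply: is_derive_eq; rewrite scaler0 !add0r /GRing.scale /= mulr1.
Qed.

Lemma is_derive_dotv (f g : R -> 'rV[R]_n) (t : R) df dg :
  is_derive t 1 f df -> is_derive t 1 g dg ->
  is_derive t 1 (fun s => dotv (f s) (g s)) (dotv df (g t) + dotv (f t) dg).
Proof.
move=> fd gd; rewrite /dotv -big_split /=.
have -> : (fun s => \sum_i f s 0 i * g s 0 i) = \sum_i (fun s => f s 0 i * g s 0 i).
  by apply/funext => s; rewrite fct_sumE.
apply: is_derive_sum => i.
have fi := is_derive_coord _ _ _ i fd; have gi := is_derive_coord _ _ _ i gd.
apply: is_derive_eq; rewrite addrC; congr (_ + _); by rewrite /GRing.scale /= mulrC.
Qed.

Lemma is_derive_sqnorm (f : R -> 'rV[R]_n) (t : R) df :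
  is_derive t 1 f df ->
  is_derive t 1 (fun s => sqnorm (f s)) (2 * dotv (f t) df).
Proof.
move=> fd; apply: (is_derive_eq (is_derive_dotv _ _ _ _ _ fd fd)).
by rewrite (dotvC df) mulr_natl mulr2n.
Qed.

Lemma derivative_along (phi : 'rV[R]_n -> R) (x u : 'rV[R]_n) :
  differentiable phi x -> 'd phi x u = dotv u (gradient phi x).
Proof.
move=> dphi; rewrite {1}(row_sum_delta u) linear_sum /=; apply: eq_bigr => i _.
by rewrite linearZ /= !mxE -deriveE.
Qed.

Lemma is_derive_comp_path (phi : 'rV[R]_n -> R) (f : R -> 'rV[R]_n) (t : R) df :
  differentiable phi (f t) -> is_derive t 1 f df ->
  is_derive t 1 (phi \o f) (dotv df (gradient phi (f t))).
Proof.
move=> dphi [fd dfE].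
have fd' : differentiable f t by apply/derivable1_diffP.
have cd : differentiable (phi \o f) t by exact: differentiable_comp.
apply: DeriveDef; first exact: diff_derivable.
by rewrite deriveE // diff_comp //= -(deriveE _ fd') dfE derivative_along.
Qed.

(** The chain rule, coordinate by coordinate; with row vectors the Hessian acts from the right,
    transposed. *)
Lemma is_derive_gradient_path (phi : 'rV[R]_n -> R) (f : R -> 'rV[R]_n) (t : R) df :
  differentiable (gradient phi) (f t) -> is_derive t 1 f df ->
  is_derive t 1 (gradient phi \o f) (df *m (hessian phi (f t))^T).
Proof.
move=> dphi fd.
have dpi i : differentiable (fun y => 'D_(evec R i) phi y) (f t).
  have -> : (fun y => 'D_(evec R i) phi y) = (fun M : 'rV[R]_n => M 0 i) \o gradient phi.
    by apply/funext => y /=; rewrite mxE.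
  by apply: differentiable_comp => //; exact: differentiable_coord.
suff cd i : is_derive t 1 (fun s => (gradient phi \o f) s 0 i) ((df *m (hessian phi (f t))^T) 0 i).
  exact: is_derive_rowP.
have := is_derive_comp_path _ _ _ _ (dpi i) fd.
have -> : (fun y => 'D_(evec R i) phi y) \o f = (fun s => (gradient phi \o f) s 0 i).
  by apply/funext => y /=; rewrite mxE.
congr (is_derive _ _ _ _).
by rewrite mxE; apply: eq_bigr => j _; rewrite !mxE.
Qed.

End Euclid.

(** * Strong convexity and Lipschitz gradients *)

Section Convexity.
Context {R : realType} {n : nat}.
Implicit Types (phi : 'rV[R]_n -> R) (x y u v : 'rV[R]_n).

Lemma is_derive_cvg_right (V : normedModType R) (f : R -> V) (t : R) df :
  is_derive t 1 f df -> h^-1 *: (f (t + h) - f t) @[h --> 0^'+] --> df.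
Proof.
move=> [fd dfE].
have : h^-1 *: (f (h *: 1 + t) - f t) @[h --> 0^'] --> df.
  by rewrite -dfE; exact: fd.
move=> /cvg_dnbhs_at_right; apply: cvg_trans; apply: near_eq_cvg; near=> h.
have -> : h%:A = h by rewrite /GRing.scale /= mulr1.
by rewrite (addrC h).
Unshelve. all: by end_near. Qed.

(** Strong convexity on the segment from [x] to [y] bounds the difference quotient of [phi] at
    [x + s *: (y - x)]; let [s] tend to [0] from the right. *)
Lemma strongly_convex_gradient phi mu x y :
  differentiable phi x -> strongly_convex mu phi ->
  phi x + dotv (y - x) (gradient phi x) + mu / 2 * sqnorm (y - x) <= phi y.
Proof.
move=> dphi sc.
have fd : is_derive (0 : R) 1 (fun s : R => x + s *: (y - x)) (y - x).
  exact: is_derive_line.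
have hd : is_derive (0 : R) 1 (phi \o (fun s : R => x + s *: (y - x)))
    (dotv (y - x) (gradient phi x)).
  have := is_derive_comp_path phi _ _ _ _ fd.
  by rewrite scale0r addr0; apply.
have r0 : (phi y - phi x - mu / 2 * (1 - s) * sqnorm (y - x)) @[s --> (0:R)^'+]
    --> phi y - phi x - mu / 2 * (1 - 0) * sqnorm (y - x).
  apply: cvgB; first exact: cvg_cst.
  apply: cvgMr_tmp; apply: cvgMl_tmp; apply: cvgB; first exact: cvg_cst.
  exact: cvg_at_right_filter.
suff : dotv (y - x) (gradient phi x) <=
    phi y - phi x - mu / 2 * (1 - 0) * sqnorm (y - x) by lra.
apply: (ler_cvg_to (is_derive_cvg_right _ _ _ _ hd) r0); near=> s.
have s0 : 0 < s by near: s; exact: nbhs_right_gt.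
have s1 : s <= 1 by near: s; exact: nbhs_right_le.
have := sc y x s; rewrite (ltW s0) s1 => /(_ isT).
have -> : s *: y + (1 - s) *: x = x + s *: (y - x).
  by rewrite scalerBl scalerBr scale1r addrCA addrA addrC addrA.
rewrite /= scale0r addr0 add0r /GRing.scale /= => H.
rewrite -ler_pdivlMl ?invr_gt0 // invrK; nra.
Unshelve. all: by end_near. Qed.

(** Young's inequality with weight [mu] cancels the quadratic term of the strong convexity lower
    bound. *)
Lemma polyak_lojasiewicz phi mu x y :
  0 < mu -> differentiable phi x -> strongly_convex mu phi ->
  phi x - phi y <= (2 * mu)^-1 * sqnorm (gradient phi x).
Proof.
move=> mu0 dphi sc; have := strongly_convex_gradient _ _ _ y dphi sc.
have := dotv_young _ (- (y - x)) (gradient phi x) mu0.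
rewrite /sqnorm !(dotvNl, dotvNr) invfM.
set a := dotv _ (gradient phi x); lra.
Qed.

Lemma strongly_monotone_gradient phi mu x y :
  (forall z, differentiable phi z) -> strongly_convex mu phi ->
  mu * sqnorm (y - x) <= dotv (y - x) (gradient phi y - gradient phi x).
Proof.
move=> dphi sc.
have := strongly_convex_gradient _ _ _ y (dphi x) sc.
have := strongly_convex_gradient _ _ _ x (dphi y) sc.
rewrite -(opprB y x) /sqnorm !dotvE; lra.
Qed.

(** For [f] the trajectory and [g] the gradient along it, this bounds the Hessian applied to the
    velocity without any operator norm: the Lipschitz inequality is divided by the squared increment
    of time and passed to the limit. *)
Lemma sqnorm_derive_lipschitz (f g : R -> 'rV[R]_n) (t L : R) df dg :
  is_derive t 1 f df -> is_derive t 1 g dg ->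
  (forall s, enorm (g s - g t) <= L * enorm (f s - f t)) ->
  sqnorm dg <= L ^+ 2 * sqnorm df.
Proof.
move=> /is_derive_cvg_right fd /is_derive_cvg_right gd fg.
have fd2 : L ^+ 2 * sqnorm (h^-1 *: (f (t + h) - f t)) @[h --> 0^'+] --> L ^+ 2 * sqnorm df.
  by apply: cvgMl_tmp; exact: cvg_dotv.
have gd2 : sqnorm (h^-1 *: (g (t + h) - g t)) @[h --> 0^'+] --> sqnorm dg.
  exact: cvg_dotv.
apply: (ler_cvg_to gd2 fd2); near=> s.
rewrite /sqnorm /= !dotvZl !dotvZr !mulrA.
have /enorm_le_sqnorm := fg (t + s).
rewrite /sqnorm => H; rewrite -!(mulrA _ s^-1 s^-1) -!(mulrA _ (s^-1 * s^-1)).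
rewrite [leRHS]mulrCA ler_wpM2l // -expr2 sqr_ge0 //.
Unshelve. all: by end_near. Qed.

(** The same limit applied to strong monotonicity of the gradient; it yields the coercivity of the
    Hessian damping in the direction of the velocity. *)
Lemma dotv_derive_monotone (f g : R -> 'rV[R]_n) (t mu : R) df dg :
  is_derive t 1 f df -> is_derive t 1 g dg ->
  (forall s, mu * sqnorm (f s - f t) <= dotv (f s - f t) (g s - g t)) ->
  mu * sqnorm df <= dotv df dg.
Proof.
move=> /is_derive_cvg_right fd /is_derive_cvg_right gd fg.
have fd2 : mu * sqnorm (h^-1 *: (f (t + h) - f t)) @[h --> 0^'+] --> mu * sqnorm df.
  by apply: cvgMl_tmp; exact: cvg_dotv.
have gd2 : dotv (h^-1 *: (f (t + h) - f t)) (h^-1 *: (g (t + h) - g t)) @[h --> 0^'+]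
    --> dotv df dg.
  exact: cvg_dotv.
apply: (ler_cvg_to fd2 gd2); near=> s.
rewrite /sqnorm /= !dotvZl !dotvZr.
have H := fg (t + s).
rewrite -/(sqnorm _) !(mulrA s^-1) (mulrCA mu) ler_wpM2l // -expr2 sqr_ge0 //.
Unshelve. all: by end_near. Qed.

End Convexity.

(** * A Gronwall estimate *)

Section RealDerivatives.
Context {R : realType}.
Implicit Types (f g : R -> R) (t : R).

Lemma is_derive_addf f g t df dg : is_derive t 1 f df -> is_derive t 1 g dg ->
  is_derive t 1 (fun s => f s + g s) (df + dg).
Proof. exact: is_deriveD. Qed.

Lemma is_derive_mulf f g t df dg : is_derive t 1 f df -> is_derive t 1 g dg ->
  is_derive t 1 (fun s => f s * g s) (df * g t + f t * dg).
Proof.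
move=> fd gd; apply: (is_derive_eq (is_deriveM fd gd)).
by rewrite /GRing.scale /= addrC mulrC.
Qed.

Lemma is_derive_mulcf (a : R) f t df : is_derive t 1 f df ->
  is_derive t 1 (fun s => a * f s) (a * df).
Proof.
move=> fd; apply: (is_derive_eq (is_derive_mulf _ _ _ _ _ (is_derive_cst a t 1) fd)).
by rewrite mul0r add0r.
Qed.

Lemma is_derive_invf t : 0 < t -> is_derive t 1 (fun s : R => s^-1) (- t ^- 2).
Proof.
move=> t0; have := @is_deriveV R id t 1 1 (lt0r_neq0 t0) (is_derive_id t 1).
by rewrite /GRing.scale /= mulr1.
Qed.

Lemma is_derive_expRM (a t : R) :
  is_derive t 1 (fun s => expR (a * s)) (a * expR (a * t)).
Proof.
have d : is_derive t 1 (fun s : R => a * s) a.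
  by apply: (is_derive_eq (is_derive_mulcf a id t 1 (is_derive_id t 1))); rewrite mulr1.
by apply: (is_derive_eq (@is_derive1_comp R expR (fun s => a * s) t _ _ _ d)); rewrite mulrC.
Qed.

Lemma is_derive_cube t : is_derive t 1 (fun s : R => s ^+ 3) (3 * t ^+ 2).
Proof.
apply: DeriveDef; first exact: exprn_derivable.
by rewrite exp_derive /GRing.scale /= mulr1.
Qed.

(** With the integrating factor [expR (- A * s)], the function [f] below is nonincreasing and tends
    to [0] at [0]; on times at most [1] the factor [expR (A * t)] is then replaced by [expR A]. *)
Lemma gronwall_cube (F dF : R -> R) (A B : R) : 0 <= A -> 0 <= B ->
  F t @[t --> 0^'+] --> (0 : R) ->
  (forall t, 0 < t <= 1 -> is_derive t 1 F (dF t)) ->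
  (forall t, 0 < t <= 1 -> dF t <= A * F t + B * t ^+ 2) ->
  forall t, 0 < t <= 1 -> F t <= expR A * B * t ^+ 3.
Proof.
move=> A0 B0 F0 Fd dFle t t01.
pose f (s : R) : R := expR (- A * s) * F s + - B * s ^+ 3.
pose df (s : R) : R := (- A * expR (- A * s)) * F s + expR (- A * s) * dF s + - B * (3 * s ^+ 2).
have fd (s : R) : 0 < s <= 1 -> is_derive s 1 f (df s).
  move=> s01; apply: is_derive_addf; last by apply: is_derive_mulcf; exact: is_derive_cube.
  by apply: is_derive_mulf; [exact: is_derive_expRM|exact: Fd].
have f0 : f s @[s --> 0^'+] --> (0 : R).
  suff : f s @[s --> 0^'+] --> expR (- A * 0) * 0 + - B * 0 ^+ 3.
    by rewrite mulr0 expr0n /= mulr0 addr0.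
  apply: cvgD.
    apply: cvgM => //; apply: (@continuous_cvg _ _ _ _ _ (fun s : R => - A * s) (@expR R)).
      exact: continuous_expR.
    by apply: cvgMl_tmp; apply: cvg_at_right_filter; exact: cvg_id.
  by apply: cvgMl_tmp; apply: cvg_at_right_filter; exact: exprn_continuous.
have df0 (s : R) : 0 < s < 1 -> df s <= 0.
  move=> /andP[s0 s1]; rewrite /df.
  have s01 : 0 < s <= 1 by rewrite s0 ltW.
  have e0 := expR_gt0 (- A * s).
  have e1 : expR (- A * s) <= 1 by rewrite -[leRHS]expR0 ler_expR; nra.
  have := dFle s s01; rewrite -(ler_pM2l e0) => H.
  (* The integrating factor is at most [1], so the source contributes at most [B * s ^+ 2], while
     the subtracted cube has derivative [3 * B * s ^+ 2]. *)
  have Bs : 0 <= B * s ^+ 2 by rewrite mulr_ge0 // sqr_ge0.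
  have : expR (- A * s) * (B * s ^+ 2) <= B * s ^+ 2 by rewrite ler_piMl.
  rewrite mulrDr in H; lra.
have := @ler0_is_derive_le_lim R f df 1 0 f0 fd df0 t t01.
rewrite /f => H.
have e0 := expR_gt0 (A * t).
have ee : expR (A * t) * expR (- A * t) = 1 by rewrite -expRD mulNr subrr expR0.
have H1 : F t <= expR (A * t) * (B * t ^+ 3).
  have : expR (A * t) * (expR (- A * t) * F t) <= expR (A * t) * (B * t ^+ 3).
    by rewrite ler_pM2l //; lra.
  by rewrite mulrA ee mul1r.
apply: (le_trans H1); rewrite -mulrA ler_wpM2r //.
  by rewrite mulr_ge0 // exprn_ge0 // ltW //; case/andP: t01.
by rewrite ler_expR; case/andP: t01 => ? ?; rewrite ler_piMr.
Qed.

End RealDerivatives.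

(** * Constants of the initial window *)

Section Constants.
Context {R : realType} (alpha beta L : R).

(* Growth rate, for [t <= 1], of [|v + t gam|^2 + |x - z|^2 / t] along the solution. *)
Definition gronwall_rate := L ^+ 2 / alpha + 2 + 2 * beta ^+ 2 * L ^+ 2 / alpha.

Definition start_const := expR gronwall_rate * gronwall_rate.

(* Slope in [t] of the bound on the squared relative errors of [v / t + gam] and
[acc + gam], divided by [|gam|^2]. *)
Definition start_slope :=
  4 * L ^+ 2 * start_const + 8 * beta ^+ 2 * L ^+ 2 * (start_const + 1)
  + 2 * alpha ^+ 2 * start_const + start_const.

(* Keeps those squared errors below [1 / 16]. *)
Definition start_window := (16 * (1 + start_slope))^-1.

Lemma gronwall_rate_ge0 : 0 < alpha -> 0 <= gronwall_rate.
Proof.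
move=> /ltW a0; rewrite /gronwall_rate.
by do ![apply: addr_ge0|apply: divr_ge0|exact: sqr_ge0|apply: mulr_ge0|done].
Qed.

Lemma start_const_ge0 : 0 < alpha -> 0 <= start_const.
Proof. by move=> a0; rewrite mulr_ge0 ?expR_ge0 ?gronwall_rate_ge0. Qed.

Lemma start_slope_ge0 : 0 < alpha -> 0 <= start_slope.
Proof.
move=> /start_const_ge0 D0; rewrite /start_slope.
by do ![done|apply: addr_ge0|exact: sqr_ge0|apply: mulr_ge0].
Qed.

Lemma start_window_gt0 : 0 < alpha -> 0 < start_window.
Proof. by move=> a0; rewrite invr_gt0 mulr_gt0 // ltr_wpDr ?start_slope_ge0. Qed.

Lemma start_windowE : 0 < alpha -> 16 * start_window * (1 + start_slope) = 1.
Proof.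
move=> a0; have := start_slope_ge0 a0; rewrite /start_window => s0; field.
by rewrite gt_eqF // ltr_wpDr.
Qed.

End Constants.

(** * The solution near the initial time *)

Section Trajectory.
Context {R : realType} {n : nat}.
Context (phi : 'rV[R]_n -> R) (mu L alpha beta : R) (z : 'rV[R]_n) (x : R -> 'rV[R]_n).
Context (phi_diff : forall y, differentiable phi y).
Context (grad_diff : forall y, differentiable (gradient phi) y).
Context (mu_gt0 : 0 < mu) (phi_sc : strongly_convex mu phi) (phi_lip : lipschitz_grad L phi).
Context (alpha_gt0 : 0 < alpha) (beta_gt0 : 0 < beta).
Context (x_sol : din_avd_sol phi alpha beta z x).

Implicit Types t : R.

Let v := derive1 x.
Let acc := derive1 v.
Let G t := gradient phi (x t).
Let dG t := v t *m (hessian phi (x t))^T.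

Lemma is_derive_traj t : 0 < t -> is_derive t 1 x (v t).
Proof.
move=> t0; case: x_sol => _ _ _ + _ => /(_ t t0)[xd _].
by rewrite /v derive1E; exact: derivableP.
Qed.

Lemma is_derive_velocity t : 0 < t -> is_derive t 1 v (acc t).
Proof.
move=> t0; case: x_sol => _ _ _ + _ => /(_ t t0)[_ [vd _]].
by rewrite /acc derive1E; exact: derivableP.
Qed.

Lemma is_derive_grad_traj t : 0 < t -> is_derive t 1 G (dG t).
Proof. by move=> t0; exact: is_derive_gradient_path (is_derive_traj t t0). Qed.

Lemma is_derive_phi_traj t : 0 < t -> is_derive t 1 (phi \o x) (dotv (v t) (G t)).
Proof. by move=> t0; exact: is_derive_comp_path (is_derive_traj t t0). Qed.

Lemma accE t : 0 < t -> acc t = - ((alpha / t) *: v t + beta *: dG t + G t).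
Proof.
move=> t0; case: x_sol => _ _ _ _ /(_ t t0).
by rewrite -!addrA => /eqP; rewrite addr_eq0 /acc /v => /eqP ->; rewrite !addrA.
Qed.

Lemma traj_cvg0 : x t @[t --> 0^'+] --> z.
Proof.
case: x_sol => x0 + _ _ _ => q0.
have idc : t @[t --> (0 : R)^'+] --> (0 : R) by apply: cvg_at_right_filter; exact: cvg_id.
have H : z + h *: (h^-1 *: (x h - x 0)) @[h --> (0 : R)^'+] --> z.
  have zE : z = z + (0 : R) *: (0 : 'rV[R]_n) by rewrite scaler0 addr0.
  by rewrite [X in _ --> X]zE; apply: cvgD; [exact: cvg_cst|exact: cvgZ idc q0].
apply: cvg_trans H; apply: near_eq_cvg; near=> h.
have h0 : 0 < h by near: h; exact: nbhs_right_gt.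
by rewrite /= x0 scalerA divff ?gt_eqF // scale1r addrC subrK.
Unshelve. all: by end_near. Qed.

Lemma velocity_cvg0 : v t @[t --> 0^'+] --> (0 : 'rV[R]_n).
Proof. by case: x_sol. Qed.

Lemma sqnorm_dgrad_le t : 0 < t -> sqnorm (dG t) <= L ^+ 2 * sqnorm (v t).
Proof.
move=> t0; apply: sqnorm_derive_lipschitz (is_derive_traj t t0) (is_derive_grad_traj t t0) _.
by move=> s; exact: phi_lip.
Qed.

Lemma dotv_velocity_dgrad_ge t : 0 < t -> mu * sqnorm (v t) <= dotv (v t) (dG t).
Proof.
move=> t0; apply: dotv_derive_monotone (is_derive_traj t t0) (is_derive_grad_traj t t0) _.
by move=> s; exact: strongly_monotone_gradient.
Qed.

(** The factor is such that [- t *: gam] solves [v' + (alpha / t) v + gradient phi z = 0], the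
    equation with the gradient frozen at [z] and the Hessian term dropped. *)
Let gam := (1 + alpha)^-1 *: gradient phi z.
Let N := sqnorm gam.
(* In terms of [w] and [r] the equation reads [t w' + alpha w = t r]; the damping
term [alpha / t] absorbs [w] in [(|w|^2)' <= t |r|^2 / (2 alpha)]. *)
Let w t := v t + t *: gam.
Let W t := sqnorm (w t).
Let P t := t^-1 * sqnorm (x t - z).
Let r t := - (G t - gradient phi z) - beta *: dG t.

Let gradE : gradient phi z = (1 + alpha) *: gam.
Proof. by rewrite scalerA divff ?scale1r // gt_eqF // addr_gt0. Qed.

Let acc_gamE t : 0 < t -> acc t + gam = r t - (alpha / t) *: w t.
Proof.
move=> t0; rewrite accE // /r gradE /w; move: gam (v t) (dG t) (G t) => c a b d.
by apply/rowP => i; rewrite !mxE; field; rewrite gt_eqF.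
Qed.

Let sqnorm_r_le t : 0 < t ->
  sqnorm (r t) <= 2 * L ^+ 2 * (t * P t) + 2 * beta ^+ 2 * L ^+ 2 * sqnorm (v t).
Proof.
move=> t0; apply: (le_trans (sqnormD_le _ _)).
have -> : sqnorm (- (G t - gradient phi z)) = sqnorm (G t - gradient phi z).
  by rewrite /sqnorm dotvNl dotvNr opprK.
have -> : sqnorm (- (beta *: dG t)) = beta ^+ 2 * sqnorm (dG t).
  by rewrite /sqnorm dotvNl dotvNr opprK dotvZl dotvZr mulrA.
have := enorm_le_sqnorm _ _ _ (phi_lip (x t) z).
have := sqnorm_dgrad_le t t0.
rewrite /P (mulrA t) divff ?gt_eqF // mul1r.
have := sqr_ge0 beta; rewrite /G; nra.
Qed.

Let sqnorm_v_le t : sqnorm (v t) <= 2 * W t + 2 * t ^+ 2 * N.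
Proof.
have -> : v t = w t + (- t) *: gam by rewrite scaleNr addrK.
apply: (le_trans (sqnormD_le _ _)).
have -> : sqnorm (- t *: gam) = t ^+ 2 * N.
  by rewrite /N; move: gam => c; rewrite /sqnorm dotvZl dotvZr mulrA mulrNN.
by rewrite mulrA.
Qed.

Let is_derive_W t : 0 < t -> is_derive t 1 W (2 * dotv (w t) (acc t + gam)).
Proof.
move=> t0; apply: is_derive_sqnorm; apply: is_deriveD; first exact: is_derive_velocity.
have := is_derive_line 0 gam t; congr (is_derive _ _ _ _).
by apply/funext => s; rewrite add0r.
Qed.

(** The weight [2 * alpha / t] in Young's inequality matches the damping term exactly. *)
Let derive_W_le t : 0 < t ->
  2 * dotv (w t) (acc t + gam) <= t / (2 * alpha) * sqnorm (r t).
Proof.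
move=> t0; rewrite acc_gamE // dotvDr dotvNr dotvZr.
have at0 : 0 < 2 * alpha / t by rewrite divr_gt0 // mulr_gt0.
have := dotv_young _ (w t) (r t) at0.
rewrite invf_div -/(sqnorm (w t)); lra.
Qed.

Let is_derive_P t : 0 < t ->
  is_derive t 1 P (- t ^- 2 * sqnorm (x t - z) + t^-1 * (2 * dotv (x t - z) (v t))).
Proof.
move=> t0; apply: is_derive_mulf; first exact: is_derive_invf.
apply: is_derive_sqnorm; apply: is_derive_eq; last exact: subr0.
by apply: is_deriveB; exact: is_derive_traj.
Qed.

(** The negative term produced by differentiating [t^-1] absorbs the square of [x t - z] left by
    Young's inequality with weight [t^-1]. *)
Let derive_P_le t : 0 < t ->
  - t ^- 2 * sqnorm (x t - z) + t^-1 * (2 * dotv (x t - z) (v t)) <= sqnorm (v t).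
Proof.
move=> t0; have ti0 : 0 < t^-1 by rewrite invr_gt0.
have := dotv_young _ (x t - z) (v t) ti0.
rewrite -(ler_pM2l ti0) invrK mulrDr mulKf ?gt_eqF // -[t ^- 2]exprVn; lra.
Qed.

Let D := start_const alpha beta L.

(** Neither [W] nor [P] satisfies a closed differential inequality: [r] involves the displacement,
    and the displacement grows with the velocity. Their sum does, with rate [gronwall_rate] and a
    source proportional to [N * t ^+ 2]. *)
Lemma start_deviation_le t : 0 < t <= 1 -> W t + P t <= D * N * t ^+ 3.
Proof.
move=> t01; set A := gronwall_rate alpha beta L.
have N0 : 0 <= N by exact: sqnorm_ge0.
have A0 : 0 <= A by exact: gronwall_rate_ge0.
have -> : D * N * t ^+ 3 = expR A * (A * N) * t ^+ 3 by rewrite /D /start_const -/A !mulrA.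
move: t t01; apply: (@gronwall_cube R (fun t => W t + P t)
  (fun t => 2 * dotv (w t) (acc t + gam) +
    (- t ^- 2 * sqnorm (x t - z) + t^-1 * (2 * dotv (x t - z) (v t)))) A) => //.
- exact: mulr_ge0.
- suff : W t + P t @[t --> 0^'+] --> sqnorm (0 + 0 *: gam) + dotv (0 : 'rV[R]_n) (z - z).
    by rewrite scale0r addr0 /sqnorm !dotv0l addr0.
  have idc : t @[t --> (0 : R)^'+] --> (0 : R) by apply: cvg_at_right_filter; exact: cvg_id.
  apply: cvgD.
    have wc : w t @[t --> 0^'+] --> 0 + 0 *: gam.
      by apply: cvgD; [exact: velocity_cvg0|exact: cvgZr_tmp].
    exact: cvg_dotv.
  case: x_sol => x0 q0 _ _ _.
  have dc : x t - z @[t --> 0^'+] --> z - z.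
    by apply: cvgB; [exact: traj_cvg0|exact: cvg_cst].
  (* As an inner product of the difference quotient at [0] with the displacement, [P] is seen to
     vanish at [0] although it contains [t^-1]. *)
  rewrite x0 in q0; have -> : P = fun t => dotv (t^-1 *: (x t - z)) (x t - z).
    by apply/funext => t; rewrite dotvZl.
  exact: cvg_dotv.
- by move=> t /andP[t0 _]; apply: is_derive_addf; [exact: is_derive_W|exact: is_derive_P].
- move=> t /andP[t0 t1].
  have V := sqnorm_v_le t; have Q := sqnorm_r_le t t0.
  have W0 : 0 <= W t by exact: sqnorm_ge0.
  have P0 : 0 <= P t by rewrite mulr_ge0 ?invr_ge0 ?(ltW t0) ?sqnorm_ge0.
  have b0 : 0 <= 2 * beta ^+ 2 * L ^+ 2 by do ![exact: sqr_ge0|apply: mulr_ge0|done].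
  have Q2 : sqnorm (r t) <= 2 * L ^+ 2 * (t * P t)
      + 2 * beta ^+ 2 * L ^+ 2 * (2 * W t + 2 * t ^+ 2 * N).
    by apply: (le_trans Q); rewrite lerD2l ler_wpM2l.
  have ta0 : 0 <= t / (2 * alpha) by apply: divr_ge0; [exact: ltW|apply: mulr_ge0 => //; exact: ltW].
  have HW := le_trans (derive_W_le t t0) (ler_wpM2l ta0 Q2).
  have HP := le_trans (derive_P_le t t0) V.
  apply: (le_trans (lerD HW HP)).
  have -> : t / (2 * alpha) * (2 * L ^+ 2 * (t * P t)
      + 2 * beta ^+ 2 * L ^+ 2 * (2 * W t + 2 * t ^+ 2 * N)) =
      L ^+ 2 / alpha * (t ^+ 2 * P t) + 2 * beta ^+ 2 * L ^+ 2 / alpha *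
      (t * (W t + t ^+ 2 * N)).
    by field; rewrite gt_eqF.
  rewrite /A /gronwall_rate.
  have : 0 <= L ^+ 2 / alpha by apply: divr_ge0; [exact: sqr_ge0|exact: ltW].
  have : 0 <= 2 * beta ^+ 2 * L ^+ 2 / alpha by apply: divr_ge0 => //; exact: ltW.
  move: (L ^+ 2 / alpha) (2 * beta ^+ 2 * L ^+ 2 / alpha) => a b bb aa.
  have tN : 0 <= t ^+ 2 * N by rewrite mulr_ge0 ?sqr_ge0.
  (* Since [t <= 1], surplus powers of [t] are dropped; the remaining coefficients [a], [b] and [2]
     add up to [gronwall_rate]. *)
  have t2 : t ^+ 2 <= 1 by rewrite expr_le1 // ltW.
  have h1 : a * (t ^+ 2 * P t) <= a * P t by rewrite ler_wpM2l // ler_piMl.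
  have h2 : b * (t * (W t + t ^+ 2 * N)) <= b * (W t + t ^+ 2 * N).
    by rewrite ler_wpM2l // ler_piMl // addr_ge0.
  have h3 : 0 <= a * W t by exact: mulr_ge0.
  have h4 : 0 <= a * (t ^+ 2 * N) by exact: mulr_ge0.
  have h5 : 0 <= b * P t by exact: mulr_ge0.
  lra.
Qed.

Let tau := start_window alpha beta L.

(** Up to the factor [t] in the velocity, both [v t] and [acc t] equal [- gam] plus an error, [om]
    and [a] respectively. The squared errors are [O(t * N)], so on the window they are small
    relative to [gam]. *)
Lemma start_estimates t : 0 < t <= tau ->
  t ^+ 2 * N / 4 <= sqnorm (v t) /\ t * N / 4 <= dotv (v t) (acc t).
Proof.
move=> /andP[t0 tt].
have N0 : 0 <= N by exact: sqnorm_ge0.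
have D0 : 0 <= D by exact: start_const_ge0.
have S0 := start_slope_ge0 alpha beta L alpha_gt0.
have tauE := start_windowE alpha beta L alpha_gt0; rewrite -/tau in tauE.
have t1 : t <= 1 by nra.
have W0 : 0 <= W t by exact: sqnorm_ge0.
have P0 : 0 <= P t by rewrite mulr_ge0 ?invr_ge0 ?(ltW t0) ?sqnorm_ge0.
have F : W t + P t <= D * N * t ^+ 3 by apply: start_deviation_le; rewrite t0.
pose om := t^-1 *: w t; pose a := r t - alpha *: om.
have wE : w t = t *: om by rewrite scalerA divff ?scale1r // gt_eqF.
have vE : v t = t *: (om - gam) by rewrite scalerBr -wE addrK.
have accE' : acc t = a - gam.
  apply/eqP; rewrite -subr_eq opprK acc_gamE // /a wE scalerA divfK // gt_eqF //.
have t3 : t ^+ 3 = t ^+ 2 * t by rewrite exprSr.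
have t20 : 0 < t ^+ 2 by rewrite exprn_gt0.
have DN0 : 0 <= D * N by exact: mulr_ge0.
have Wom : W t = t ^+ 2 * sqnorm om by rewrite /W wE /sqnorm dotvZl dotvZr mulrA.
have om_le : sqnorm om <= t * N * D.
  rewrite -(ler_pM2l t20) -Wom.
  have -> : t ^+ 2 * (t * N * D) = D * N * t ^+ 3 by ring.
  lra.
have DNt : D * N * t ^+ 3 <= t * N * D.
  have : t ^+ 3 <= t by rewrite t3 ler_piMl ?(ltW t0) // expr_le1 // ltW.
  by move=> /(ler_wpM2l DN0); lra.
have tP_le : t * P t <= t * N * D by apply: (@le_trans _ _ (P t)); [rewrite ler_piMl|lra].
have v_le : sqnorm (v t) <= 2 * (t * N * (D + 1)).
  apply: (le_trans (sqnorm_v_le t)).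
  have : t ^+ 2 * N <= t * N by rewrite ler_wpM2r // expr2 ler_piMl // ltW.
  lra.
have b0 : 0 <= 2 * beta ^+ 2 * L ^+ 2 by do ![exact: sqr_ge0|apply: mulr_ge0|done].
have l0 : 0 <= 2 * L ^+ 2 by do ![exact: sqr_ge0|apply: mulr_ge0|done].
have r_le := le_trans (sqnorm_r_le t t0) (lerD (ler_wpM2l l0 tP_le) (ler_wpM2l b0 v_le)).
have a_le : sqnorm a <= 2 * sqnorm (r t) + 2 * (alpha ^+ 2 * sqnorm om).
  apply: (le_trans (sqnormD_le _ _)).
  have -> // : sqnorm (- (alpha *: om)) = alpha ^+ 2 * sqnorm om.
  by rewrite /sqnorm dotvNl dotvNr opprK dotvZl dotvZr mulrA.
(* The coefficients of [t * N] in the bounds on [a] and [om] add up to [start_slope], and [t] times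
   that slope is at most [1 / 16] on the window. *)
have sum_le : sqnorm a + sqnorm om <= N / 16.
  have := ler_wpM2l (sqr_ge0 alpha) om_le.
  have : t * N * start_slope alpha beta L <= N / 16.
    have : t * start_slope alpha beta L <= 1 / 16 by nra.
    by move=> /(ler_wpM2l N0); lra.
  by rewrite /start_slope -/D; lra.
clearbody a om.
have oa := dotv_young 1 (- om) a ltr01.
rewrite invr1 dotvNl /sqnorm dotvNl dotvNr opprK -!/(sqnorm _) in oa.
(* With weight [2], each product [dotv om gam] and [dotv a gam] costs [N / 4] plus a squared error;
   at least [N / 2] minus small errors survives in both estimates. *)
have two_gt0 : 0 < 2 :> R by [].
have og := dotv_young _ om gam two_gt0; have ag := dotv_young _ a gam two_gt0.
rewrite -/N in og ag.
rewrite vE accE' /sqnorm !dotvZl !dotvZr.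
have -> : dotv (om - gam) (om - gam) = sqnorm om - 2 * dotv om gam + N.
  rewrite /N; move: gam => c; rewrite /sqnorm !dotvE (dotvC c); ring.
have -> : dotv (om - gam) (a - gam) = dotv om a - dotv om gam - dotv a gam + N.
  rewrite /N; move: gam => c; rewrite /sqnorm !dotvE (dotvC c); ring.
have om0 := sqnorm_ge0 om; have a0 := sqnorm_ge0 a.
split.
  rewrite mulrA -expr2 -mulrA ler_wpM2l ?(ltW t20) //; lra.
rewrite -mulrA ler_wpM2l ?(ltW t0) //; lra.
Qed.

End Trajectory.

(** * One piece of the restarted trajectory *)

Section RestartedPiece.
Context {R : realType} {n : nat}.
Context (phi : 'rV[R]_n -> R) (mu L alpha beta lam : R) (z : 'rV[R]_n) (x : R -> 'rV[R]_n).
Context (phi_diff : forall y, differentiable phi y).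
Context (grad_diff : forall y, differentiable (gradient phi) y).
Context (mu_gt0 : 0 < mu) (phi_sc : strongly_convex mu phi) (phi_lip : lipschitz_grad L phi).
Context (alpha_gt0 : 0 < alpha) (beta_gt0 : 0 < beta).
Context (lam01 : 0 <= lam <= 1) (lam_le : lam <= (2 * alpha)^-1).
Context (x_sol : din_avd_sol phi alpha beta z x).
Implicit Types (t T : R) (y : 'rV[R]_n).

Let v := derive1 x.
Let acc := derive1 v.
Let G t := gradient phi (x t).
Let dG t := v t *m (hessian phi (x t))^T.
Let N := sqnorm ((1 + alpha)^-1 *: gradient phi z).
Let tau := start_window alpha beta L.
(** The ratio of the guaranteed decrease [beta * mu * N / 12 * tau ^+ 3] on the initial window to
    the bound of [gap_le] on the gap; [N] cancels, so [q] does not depend on [z]. *)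
Let q := beta * mu ^+ 2 * tau ^+ 3 / (6 * (1 + alpha) ^+ 2).

Let tau_gt0 : 0 < tau. Proof. exact: start_window_gt0. Qed.

Let N_ge0 : 0 <= N. Proof. exact: sqnorm_ge0. Qed.

Let bm_gt0 : 0 < beta * mu. Proof. exact: mulr_gt0. Qed.

Let is_derive_v t : 0 < t -> is_derive t 1 v (acc t).
Proof. exact: (is_derive_velocity phi alpha beta z x x_sol). Qed.

Let is_derive_phix t : 0 < t -> is_derive t 1 (phi \o x) (dotv (v t) (G t)).
Proof. exact: (is_derive_phi_traj phi alpha beta z x phi_diff x_sol). Qed.

Let lam_alpha_le : 2 * lam * alpha <= 1.
Proof. by move: lam_le; rewrite -[leRHS]mul1r ler_pdivlMr ?mulr_gt0 //; lra. Qed.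

Lemma varphiE t : 0 < t ->
  varphi alpha lam x t = dotv (v t) (acc t) + lam * (alpha / t) * sqnorm (v t).
Proof.
move=> t0; rewrite /varphi derive1E.
rewrite (@derive_val _ _ _ _ _ _ _ (is_derive_sqnorm _ _ _ (is_derive_v t t0))).
by rewrite (mulrA 2^-1) mulVf // mul1r.
Qed.

Lemma gap_le y : phi z - phi y <= (1 + alpha) ^+ 2 * N / (2 * mu).
Proof.
have a1 : 0 < 1 + alpha by rewrite addr_gt0.
have -> : (1 + alpha) ^+ 2 * N = sqnorm (gradient phi z).
  rewrite /N /sqnorm dotvZl dotvZr; field; rewrite gt_eqF //.
by rewrite mulrC; exact: polyak_lojasiewicz.
Qed.

Lemma slope_gt0 : ~ is_minimizer phi z -> 0 < N.
Proof.
move=> nz; rewrite lt_neqAle N_ge0 andbT; apply/eqP => N0; apply: nz => y.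
by have := gap_le y; rewrite -N0 mulr0 mul0r subr_le0.
Qed.

Lemma varphi_start_gt0 t : 0 < N -> 0 < t <= tau -> 0 < varphi alpha lam x t.
Proof.
move=> N0 /andP[t0 tt]; rewrite varphiE //.
have [|_ H] := start_estimates phi L alpha beta z x grad_diff phi_lip alpha_gt0 x_sol t.
  by rewrite t0.
apply: ltr_wpDr.
  rewrite mulr_ge0 ?sqnorm_ge0 // mulr_ge0 //; first by case/andP: lam01.
  by rewrite divr_ge0 // ltW.
by apply: lt_le_trans H; rewrite divr_gt0 // mulr_gt0.
Qed.

(** Pair the equation with [v t]. The criterion bounds [- dotv (v t) (acc t)] by
    [lam * (alpha / t) * sqnorm (v t)], which the viscous damping compensates because [lam <= 1];
    the Hessian damping is left over. *)
Lemma derive_phi_le t : 0 < t -> 0 <= varphi alpha lam x t ->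
  dotv (v t) (G t) <= - (beta * mu) * sqnorm (v t).
Proof.
move=> t0; rewrite varphiE // => H.
have -> : G t = - acc t - (alpha / t) *: v t - beta *: dG t.
  rewrite /acc /v (accE phi alpha beta z x x_sol t t0) -/v.
  by apply/rowP => i; rewrite !mxE; ring.
have M := dotv_velocity_dgrad_ge phi mu alpha beta z x phi_diff grad_diff phi_sc x_sol t t0.
have {}M := ler_wpM2l (ltW beta_gt0) M.
have S := sqnorm_ge0 (v t).
have A : lam * (alpha / t) * sqnorm (v t) <= alpha / t * sqnorm (v t).
  have A0 : 0 <= alpha / t * sqnorm (v t) by apply: mulr_ge0 => //; apply: divr_ge0; exact: ltW.
  by rewrite -mulrA ler_piMl //; case/andP: lam01.
rewrite !dotvE -/(sqnorm (v t)); rewrite -/v -/(dG t) in M.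
lra.
Qed.

Let phix_cvg0 : phi (x t) @[t --> 0^'+] --> phi z.
Proof.
apply: (@continuous_cvg _ _ _ _ _ x phi); last exact: traj_cvg0 x_sol.
exact: differentiable_continuous.
Qed.

Lemma phi_traj_le t T : 0 < t <= T -> (forall s, 0 < s < T -> 0 <= varphi alpha lam x s) ->
  phi (x t) <= phi z.
Proof.
move=> tT pos; apply: (ler0_is_derive_le_lim _ (phi \o x) (fun s => dotv (v s) (G s)) T) => //.
  by move=> s /andP[s0 _]; exact: is_derive_phix.
move=> s sT; have s0 : 0 < s by case/andP: sT.
apply: (le_trans (derive_phi_le s s0 (pos s sT))).
by rewrite mulNr oppr_le0 mulr_ge0 ?sqnorm_ge0 // ltW.
Qed.

(** The decrease on [(0, tau]] already suffices; after [tau] it is enough that [phi] does not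
    increase. *)
Lemma phi_traj_contract T y : tau <= T -> (forall s, 0 < s < T -> 0 <= varphi alpha lam x s) ->
  phi y <= phi z -> phi (x T) - phi y <= expR (- q) * (phi z - phi y).
Proof.
move=> tauT pos yz.
have pos_tau s : 0 < s < tau -> 0 <= varphi alpha lam x s.
  by move=> /andP[s0 st]; apply: pos; rewrite s0 (lt_le_trans st).
have xT : phi (x T) <= phi (x tau).
  apply: (ler0_is_derive_noninc _ (phi \o x) (fun s => dotv (v s) (G s))) => // s.
    by move=> /andP[s0 _]; apply: is_derive_phix; exact: lt_le_trans s0.
  move=> /andP[ts sT]; have s0 : 0 < s by exact: lt_trans ts.
  apply: (le_trans (derive_phi_le s s0 _)); first by apply: pos; rewrite s0.
  by rewrite mulNr oppr_le0 mulr_ge0 ?sqnorm_ge0 // ltW.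
(* Integrates [beta * mu * sqnorm (v s) >= beta * mu * (s ^+ 2 * N / 4)] over the window. *)
have xtau : phi (x tau) + beta * mu * N / 12 * tau ^+ 3 <= phi z.
  apply: (ler0_is_derive_le_lim _ (fun s => phi (x s) + beta * mu * N / 12 * s ^+ 3)
    (fun s => dotv (v s) (G s) + beta * mu * N / 12 * (3 * s ^+ 2)) tau); last first.
  - by rewrite tau_gt0 lexx.
  - move=> s stau; have /andP[s0 st] := stau.
    have D := derive_phi_le s s0 (pos_tau s stau).
    have [|E _] := start_estimates phi L alpha beta z x grad_diff phi_lip alpha_gt0 x_sol s.
      by rewrite s0 ltW.
    have := ler_wpM2l (ltW bm_gt0) E; rewrite -/v -/N; lra.
  - move=> s /andP[s0 _]; apply: is_derive_addf; first exact: is_derive_phix.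
    by apply: is_derive_mulcf; exact: is_derive_cube.
  - suff : phi (x s) + beta * mu * N / 12 * s ^+ 3 @[s --> 0^'+]
      --> phi z + beta * mu * N / 12 * 0 ^+ 3 by rewrite expr0n /= mulr0 addr0.
    apply: cvgD; first exact: phix_cvg0.
    by apply: cvgMl_tmp; apply: cvg_at_right_filter; exact: exprn_continuous.
have gap := gap_le y.
have a1 : 0 < 1 + alpha by rewrite addr_gt0.
have qN : q * (phi z - phi y) <= beta * mu * N / 12 * tau ^+ 3.
  have q0 : 0 <= q.
    rewrite /q divr_ge0 ?mulr_ge0 ?exprn_ge0 ?ltW ?sqr_ge0 //.
  apply: (le_trans (ler_wpM2l q0 gap)); rewrite /q le_eqVlt; apply/orP; left; apply/eqP.
  by field; rewrite !gt_eqF.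
have e1 : 1 - q <= expR (- q) by exact: expR_ge1Dx.
have yz0 : 0 <= phi z - phi y by rewrite subr_ge0.
apply: le_trans (ler_wpM2r yz0 e1).
rewrite mulrBl mul1r; lra.
Qed.

(** From [tau] to [T] the value of [phi] drops by at least [beta * mu * c * (ln T - ln tau)], yet
    the drop cannot exceed the initial gap. *)
Lemma restart_time_bound T y : ~ is_minimizer phi z -> tau <= T ->
  (forall s, 0 < s < T -> 0 <= varphi alpha lam x s) ->
  is_minimizer phi y -> T <= tau * expR (3 * q)^-1.
Proof.
move=> /slope_gt0 N0 tauT pos ymin.
have T0 : 0 < T by exact: lt_le_trans tauT.
(* The lower bound of [start_estimates] for [s * sqnorm (v s)] at [s = tau]. *)
pose c := tau ^+ 3 * N / 4.
(* [s |v s|^2] is nondecreasing because [2 lam alpha <= 1]. *)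
have speed s : tau <= s < T -> c / s <= sqnorm (v s).
  move=> /andP[ts sT]; have s0 : 0 < s by exact: lt_le_trans ts.
  rewrite ler_pdivrMr // mulrC.
  have : - (s * sqnorm (v s)) <= - (tau * sqnorm (v tau)).
    apply: (ler0_is_derive_noninc _ (fun r => - (r * sqnorm (v r)))
      (fun r => - (1 * sqnorm (v r) + r * (2 * dotv (v r) (acc r))))) => // r.
      move=> /andP[tr _]; have r0 : 0 < r by exact: lt_le_trans tr.
      apply: is_deriveN; apply: is_derive_mulf.
      by apply: is_derive_sqnorm; exact: is_derive_v.
    move=> /andP[tr rs]; have r0 : 0 < r by exact: lt_trans tr.
    have := pos r; rewrite r0 (lt_trans rs sT) varphiE // => /(_ isT) H.
    rewrite oppr_le0 mul1r.
    have := ler_wpM2l (ltW r0) H.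
    have -> : r * (dotv (v r) (acc r) + lam * (alpha / r) * sqnorm (v r)) =
       r * dotv (v r) (acc r) + lam * alpha * sqnorm (v r) by field; rewrite gt_eqF.
    have S := sqnorm_ge0 (v r).
    have := ler_wpM2r S lam_alpha_le; lra.
  have [|E _] := start_estimates phi L alpha beta z x grad_diff phi_lip alpha_gt0 x_sol tau.
    by rewrite tau_gt0 lexx.
  rewrite lerN2; apply: le_trans.
  have := ler_wpM2l (ltW tau_gt0) E; rewrite -/v -/N /c; lra.
have c0 : 0 < beta * mu * c by rewrite !mulr_gt0 // exprn_gt0.
have logle : phi (x T) + beta * mu * c * ln T <= phi (x tau) + beta * mu * c * ln tau.
  apply: (ler0_is_derive_noninc _ (fun s => phi (x s) + beta * mu * c * ln s)
    (fun s => dotv (v s) (G s) + beta * mu * c * s^-1)) => // s.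
    move=> /andP[ts _]; have s0 : 0 < s by exact: lt_le_trans ts.
    apply: is_derive_addf; first exact: is_derive_phix.
    by apply: is_derive_mulcf; exact: is_derive1_ln.
  move=> /andP[ts sT]; have s0 : 0 < s by exact: lt_trans ts.
  have D := derive_phi_le s s0 (pos s _).
  have sp := speed s; rewrite (ltW ts) sT in sp.
  have := ler_wpM2l (ltW bm_gt0) (sp isT).
  have {}D := D _; rewrite s0 sT in D; have := D isT; lra.
have xtau : phi (x tau) <= phi z by apply: (phi_traj_le _ T) => //; rewrite tau_gt0.
have gap := gap_le y.
have lnT : ln T - ln tau <= (3 * q)^-1.
  rewrite -(ler_pM2l c0).
  (* [(3 * q)^-1] is the bound on the gap divided by [beta * mu * c]; again [N] cancels, which makes
     the bound on [T] uniform in [z]. *)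
  have -> : beta * mu * c * (3 * q)^-1 = (1 + alpha) ^+ 2 * N / (2 * mu).
    by rewrite /c /q; field; rewrite !gt_eqF // addr_gt0.
  have := ymin (x T); rewrite mulrBr; lra.
rewrite -(lnK T0) -{1}(lnK tau_gt0) -expRD ler_expR; lra.
Qed.

End RestartedPiece.

(** * The restarted trajectory *)

Section Restarting.
Context {R : realType} {n : nat}.
Context (phi : 'rV[R]_n -> R) (mu L : R) (xstar : 'rV[R]_n) (alpha beta lam : R).
Context (sol : 'rV[R]_n -> R -> 'rV[R]_n).
Context (phi_diff : forall y, differentiable phi y).
Context (grad_diff : forall y, differentiable (gradient phi) y).
Context (mu_gt0 : 0 < mu) (phi_sc : strongly_convex mu phi).
Context (xstar_min : is_minimizer phi xstar) (phi_lip : lipschitz_grad L phi).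
Context (alpha_gt0 : 0 < alpha) (beta_gt0 : 0 < beta).
Context (lam01 : 0 <= lam <= 1) (lam_le : lam <= (2 * alpha)^-1).
Context (sol_din : forall z, din_avd_sol phi alpha beta z (sol z)).
Implicit Types (z : 'rV[R]_n) (t : R) (k : nat).

Let tau := start_window alpha beta L.
Let q := beta * mu ^+ 2 * tau ^+ 3 / (6 * (1 + alpha) ^+ 2).
Let taubar := tau * expR (3 * q)^-1.
Let rtime z := restart_time sol alpha lam z.

Let tau_gt0 : 0 < tau. Proof. exact: start_window_gt0. Qed.

Let q_gt0 : 0 < q.
Proof.
by rewrite /q divr_gt0 // ?mulr_gt0 ?exprn_gt0 ?addr_gt0.
Qed.

Let taubar_gt0 : 0 < taubar. Proof. by rewrite mulr_gt0 // expR_gt0. Qed.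

Let taubar_bound z T : ~ is_minimizer phi z -> tau <= T ->
  (forall s, 0 < s < T -> 0 <= varphi alpha lam (sol z) s) -> T <= taubar.
Proof.
move=> nz tT pos.
exact: (restart_time_bound phi mu L alpha beta lam z (sol z) phi_diff grad_diff mu_gt0
  phi_sc phi_lip alpha_gt0 beta_gt0 lam01 lam_le (sol_din z) T xstar nz tT pos xstar_min).
Qed.

(** Otherwise the criterion stays positive forever and [taubar_bound] applies to arbitrarily large
    times. Nonemptiness matters because [inf] of the empty set is [0] by default. *)
Lemma restart_set_nonempty z : ~ is_minimizer phi z -> restart_set sol alpha lam z !=set0.
Proof.
move=> nz; apply/set0P/eqP => S0.
have pos s : 0 < s -> 0 <= varphi alpha lam (sol z) s.
  move=> s0; rewrite leNgt; apply/negP => /ltW H.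
  by suff : restart_set sol alpha lam z s by rewrite S0.
(* The time [taubar + tau] is at least [tau], as required, and exceeds [taubar]. *)
have := taubar_bound z (taubar + tau) nz.
rewrite lerDr ltW // => /(_ isT); rewrite gerDl leNgt tau_gt0 => H.
by suff : false by []; apply: H => s /andP[s0 _]; exact: pos.
Qed.

Lemma restart_set_lbound z : ~ is_minimizer phi z -> lbound (restart_set sol alpha lam z) tau.
Proof.
move=> nz t [t0 vt]; rewrite leNgt; apply/negP => tt.
move: vt; rewrite leNgt => /negP; apply.
apply: (varphi_start_gt0 phi L alpha beta lam z (sol z) grad_diff phi_lip alpha_gt0 lam01 (sol_din z)).
  exact: (slope_gt0 phi mu alpha z phi_diff mu_gt0 phi_sc alpha_gt0 nz).
by rewrite t0 ltW.
Qed.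

Lemma restart_time_ge z : ~ is_minimizer phi z -> tau <= rtime z.
Proof.
by move=> nz; apply: lb_le_inf; [exact: restart_set_nonempty|exact: restart_set_lbound].
Qed.

Lemma varphi_before_restart z s : ~ is_minimizer phi z -> 0 < s < rtime z ->
  0 <= varphi alpha lam (sol z) s.
Proof.
move=> nz /andP[s0 sr]; rewrite leNgt; apply/negP => /ltW H.
have : rtime z <= s by apply: ge_inf; [exists tau; exact: restart_set_lbound|].
by rewrite leNgt sr.
Qed.

Lemma restart_time_le z : ~ is_minimizer phi z -> rtime z <= taubar.
Proof.
move=> nz; apply: (taubar_bound z) => //; first exact: restart_time_ge.
by move=> s; exact: varphi_before_restart.
Qed.

Context (z0 : 'rV[R]_n).
Let zT := restart_seq phi sol alpha lam z0.

Lemma restart_seqS_min k : is_minimizer phi (zT k).1 -> zT k.+1 = zT k.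
Proof. by move=> m; rewrite /zT /= ifT //; apply/asboolP. Qed.

Lemma restart_seqS k : ~ is_minimizer phi (zT k).1 ->
  zT k.+1 = (sol (zT k).1 (rtime (zT k).1), (zT k).2 + rtime (zT k).1).
Proof. by move=> m; rewrite /zT /= ifF //; apply/asboolPn. Qed.

Lemma restart_seq_contract k :
  phi (zT k).1 - phi xstar <= expR (- q * k%:R) * (phi z0 - phi xstar).
Proof.
elim: k => [|k IH]; first by rewrite mulr0 expR0 mul1r.
have -> : - q * k.+1%:R = - q + - q * k%:R by rewrite -natr1; ring.
rewrite expRD -mulrA.
have [m|nm] := pselect (is_minimizer phi (zT k).1).
  (* At a minimizer the gap is at most [0], so the stationary step needs no contraction. *)
  rewrite restart_seqS_min //; apply: (@le_trans _ _ 0); first by rewrite subr_le0.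
  by rewrite !mulr_ge0 ?expR_ge0 // subr_ge0.
rewrite restart_seqS //; apply: le_trans (ler_wpM2l (expR_ge0 _) IH).
apply: (phi_traj_contract phi mu L alpha beta lam _ _ phi_diff grad_diff mu_gt0
  phi_sc phi_lip alpha_gt0 beta_gt0 lam01 (sol_din _)) => //.
- exact: restart_time_ge.
- by move=> s; exact: varphi_before_restart.
Qed.

Lemma restart_seq_time_le k : (zT k).2 <= k%:R * taubar.
Proof.
elim: k => [|k IH]; first by rewrite mul0r.
have [m|nm] := pselect (is_minimizer phi (zT k).1).
  by rewrite restart_seqS_min // (le_trans IH) // ler_wpM2r ?(ltW taubar_gt0) // ler_nat.
by rewrite restart_seqS //= -natr1 mulrDl mul1r lerD // restart_time_le.
Qed.

(** Rules out accumulation of the restarts at a finite time. *)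
Lemma restart_seq_time_ge k : (forall j, ~ is_minimizer phi (zT j).1) ->
  k%:R * tau <= (zT k).2.
Proof.
move=> nm; elim: k => [|k IH]; first by rewrite mul0r.
by rewrite restart_seqS //= -natr1 mulrDl mul1r lerD // restart_time_ge.
Qed.

Lemma in_piece_exists t : 0 <= t -> exists k, in_piece phi sol alpha lam z0 k t.
Proof.
move=> t0.
pose P k := `[< is_minimizer phi (zT k).1 \/ t <= (zT k.+1).2 >].
have exP : exists k, P k.
  apply: contrapT => nP.
  have {}nP k : ~ (is_minimizer phi (zT k).1 \/ t <= (zT k.+1).2).
    by move=> Pk; apply: nP; exists k; exact/asboolP.
  have nm j : ~ is_minimizer phi (zT j).1 by move=> m; apply: (nP j); left.
  have [k tk] : exists k : nat, t < k%:R * tau.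
    exists (Num.bound (t / tau)); rewrite -ltr_pdivrMr //.
    by apply: archi_boundP; rewrite divr_ge0 // ltW.
  apply: (nP k); right; apply: (le_trans _ (restart_seq_time_ge k.+1 nm)).
  by rewrite (le_trans (ltW tk)) // ler_wpM2r ?(ltW tau_gt0) // ler_nat.
have [k /asboolP Pk kmin] := ex_minnP exP.
exists k; split; last exact: Pk.
(* [k] is the first piece that is constant or ends at or after [t]. If it started after [t], the
   preceding piece would already end after [t], against minimality; piece [0] starts at time [0]. *)
case: k Pk kmin => [//|k] _ kmin.
rewrite leNgt; apply/negP => tT.
have : P k by apply/asboolP; right; exact: ltW.
by move=> /kmin; rewrite ltnn.
Qed.

(** Since [t] is at most the end of piece [k], hence at most [k.+1%:R * taubar], the [k] completed
    contractions give at least the exponent [q * (t / taubar - 1)]; the factor [expR q] pays for the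
    unfinished piece. *)
Lemma restart_piece_decay t k : 0 < t -> in_piece phi sol alpha lam z0 k t ->
  phi (restart_piece phi sol alpha lam z0 k t) - phi xstar
    <= expR q * expR (- (q / taubar) * t) * (phi z0 - phi xstar).
Proof.
move=> t0 [Tt]; rewrite -/zT in Tt *; rewrite /restart_piece -/zT.
have gap0 : 0 <= phi z0 - phi xstar by rewrite subr_ge0.
case: asboolP => [m _|nm [//|tT]].
  by apply: (@le_trans _ _ 0); rewrite ?subr_le0 // !mulr_ge0 ?expR_ge0.
have piece : phi (sol (zT k).1 (t - (zT k).2)) <= phi (zT k).1.
  (* [phi_traj_le] needs a positive elapsed time, so the restart instant itself is treated through
     the initial condition. *)
  have [->|tneq] := eqVneq t (zT k).2.
    by rewrite subrr; case: (sol_din (zT k).1) => ->.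
  apply: (phi_traj_le phi mu alpha beta lam _ _ phi_diff grad_diff mu_gt0
    phi_sc alpha_gt0 beta_gt0 lam01 (sol_din _) _ (rtime (zT k).1)).
    rewrite subr_gt0 lt_neqAle eq_sym tneq Tt /= lerBlDl.
    by move: tT; rewrite -/zT restart_seqS.
  by move=> s; exact: varphi_before_restart.
apply: (@le_trans _ _ (phi (zT k).1 - phi xstar)); first by rewrite lerB.
apply: (le_trans (restart_seq_contract k)); apply: ler_wpM2r => //.
rewrite -expRD ler_expR.
have : t / taubar <= k.+1%:R.
  by rewrite ler_pdivrMr //; exact: le_trans tT (restart_seq_time_le k.+1).
rewrite -natr1 => /(ler_wpM2l (ltW q_gt0)); lra.
Qed.

End Restarting.

Theorem mainTheorem1 (R : realType) (n : nat) (phi : 'rV[R]_n -> R)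
  (mu L : R) (xstar : 'rV[R]_n) (alpha beta lam : R)
  (sol : 'rV[R]_n -> R -> 'rV[R]_n) :
  C2 phi -> 0 < mu -> strongly_convex mu phi -> is_minimizer phi xstar ->
  lipschitz_grad L phi ->
  0 < alpha -> 0 < beta -> 0 <= lam <= 1 -> lam <= (2 * alpha)^-1 ->
  (forall z, din_avd_sol phi alpha beta z (sol z)) ->
  exists C kappa : R, 0 <= C /\ 0 < kappa /\
    forall z0 : 'rV[R]_n,
      (* the restart times are well defined (the restart sets are nonempty) *)
      (forall k, ~ is_minimizer phi (restart_seq phi sol alpha lam z0 k).1 ->
         restart_set sol alpha lam (restart_seq phi sol alpha lam z0 k).1 !=set0) /\
      (* the restarted trajectory is defined on all of [0, oo) *)
      (forall t, 0 <= t -> exists k, in_piece phi sol alpha lam z0 k t) /\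
      (* the exponential decay estimate *)
      (forall t k, 0 < t -> in_piece phi sol alpha lam z0 k t ->
         phi (restart_piece phi sol alpha lam z0 k t) - phi xstar
           <= C * expR (- kappa * t) * (phi z0 - phi xstar)).
Proof.
move=> [phi_diff [grad_diff _]] mu0 sc xmin lip a0 b0 lam01 lam_le din.
pose tau := start_window alpha beta L.
pose q := beta * mu ^+ 2 * tau ^+ 3 / (6 * (1 + alpha) ^+ 2).
have tau0 : 0 < tau by exact: start_window_gt0.
have q0 : 0 < q by rewrite /q divr_gt0 // ?mulr_gt0 ?exprn_gt0 ?addr_gt0.
(* The rate is the exponent [q] gained per piece divided by the uniform upper bound on the length of
   a piece. *)
exists (expR q), (q / (tau * expR (3 * q)^-1)); split; first exact: expR_ge0.
split; first by rewrite divr_gt0 // mulr_gt0 // expR_gt0.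
move=> z0; split; [|split].
- by move=> k; exact: (restart_set_nonempty phi mu L xstar alpha beta lam sol).
- by move=> t; exact: (in_piece_exists phi mu L xstar alpha beta lam sol).
- by move=> t k; exact: (restart_piece_decay phi mu L xstar alpha beta lam sol).
Qed.
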